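(* Let $\theta\in[0,1]$, $\epsilon>0$, and let $0=t_0<t_1<\cdots<t_N=T$ be an arbitrary time grid. Let $u_0^h,u_1^h\in X_s^h$ be given and let $u_2^h,\dots,u_N^h\in X_s^h$ be generated by the variable time-stepping modified DLN algorithm, i.e. for each $n=1,\dots,N-1$, $$\Big(\frac{u_{n,\alpha}^{h}}{\widehat{k}_{n}}, v^{h}\Big)+\epsilon^{2}\big(\nabla u_{n,\beta}^{h},\nabla v^{h}\big)+\big(\widetilde f(u_{n+1,\theta}^{h},u_{n,\theta}^{h}),v^{h}\big)=0\qquad\text{for all } v^h\in X_s^h .$$ Define, for $n=1,\dots,N$, the discrete model energy $$\mathcal{E}_{n}^{\mathrm{MOD}}:=\epsilon^2\Big(\tfrac14(1+\theta)\|\nabla u_n^h\|^2+\tfrac14(1-\theta)\|\nabla u_{n-1}^h\|^2\Big)+\int_\Omega F(u_{n,\theta}^h)\,dx .$$ Then the discrete energy dissipation law $$\mathcal{E}_{n+1}^{\mathrm{MOD}}\le \mathcal{E}_{n}^{\mathrm{MOD}},\qquad n=1,2,\dots,N-1,$$ holds; that is, the modified DLN algorithm is unconditionally stable in model energy.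
   Context: $\Omega\subset\mathbb{R}^d$ ($d=1,2,3$) is the spatial domain; $(\cdot,\cdot)$ and $\|\cdot\|$ are the $L^2(\Omega)$ inner product and norm. $X_s^h\subset H^1(\Omega)$ is a standard finite element space with highest polynomial degree $s$ and mesh diameter $h>0$. $F(u)=\frac14(u^2-1)^2$ and $f(u)=F'(u)=u^3-u$. Time steps: $k_n=t_{n+1}-t_n$, step variability $\varepsilon_n=(k_n-k_{n-1})/(k_n+k_{n-1})$, average step $\widehat k_n=\alpha_2k_n-\alpha_0k_{n-1}$. DLN coefficients with parameter $\theta\in[0,1]$: $\alpha_2=\frac12(\theta+1)$, $\alpha_1=-\theta$, $\alpha_0=\frac12(\theta-1)$, and $$\beta_2^{(n)}=\tfrac14\Big(1+\tfrac{1-\theta^2}{(1+\varepsilon_n\theta)^2}+\varepsilon_n^2\tfrac{\theta(1-\theta^2)}{(1+\varepsilon_n\theta)^2}+\theta\Big),\quad \beta_1^{(n)}=\tfrac12\Big(1-\tfrac{1-\theta^2}{(1+\varepsilon_n\theta)^2}\Big),\quad \beta_0^{(n)}=\tfrac14\Big(1+\tfrac{1-\theta^2}{(1+\varepsilon_n\theta)^2}-\varepsilon_n^2\tfrac{\theta(1-\theta^2)}{(1+\varepsilon_n\theta)^2}-\theta\Big).$$ For a sequence $\{z_n\}$: $z_{n,\theta}=\frac{1+\theta}{2}z_n+\frac{1-\theta}{2}z_{n-1}$, $z_{n,\alpha}=\sum_{\ell=0}^2\alpha_\ell z_{n-1+\ell}$, $z_{n,\beta}=\sum_{\ell=0}^2\beta_\ell^{(n)}z_{n-1+\ell}$.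 The function $\widetilde f$ is $\widetilde f(a,b)=\frac14\{[a^3+a^2b+ab^2+b^3]-2(a+b)\}$, which equals $\frac{F(a)-F(b)}{a-b}$ if $a\ne b$ and $f\big(\frac{a+b}{2}\big)$ if $a=b$. *)

(* Defs.v *)
From HB Require Import structures.
From mathcomp Require Import all_boot all_order all_algebra.
From mathcomp Require Import all_classical all_reals all_analysis.
Import Order.TTheory GRing.Theory Num.Theory.
Import numFieldNormedType.Exports.

Set Implicit Arguments.
Unset Strict Implicit.
Unset Printing Implicit Defensive.

Local Open Scope classical_set_scope.
Local Open Scope ring_scope.

Section MeasurableRowVectors.
Variables (R : realType) (n : nat).

Definition rV_coord (i : 'I_n) (x : 'rV[R]_n) : measurableTypeR R := x ord0 i.

Let rV_set0 : g_sigma_preimage rV_coord set0.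
Proof. exact: sigma_algebra0. Qed.

Let rV_setC A : g_sigma_preimage rV_coord A -> g_sigma_preimage rV_coord (~` A).
Proof. exact: sigma_algebraC. Qed.

Let rV_bigcup (F : (set 'rV[R]_n)^nat) :
  (forall i, g_sigma_preimage rV_coord (F i)) ->
  g_sigma_preimage rV_coord (\bigcup_i (F i)).
Proof. exact: sigma_algebra_bigcup. Qed.

(* The product sigma-algebra of R^n, i.e. its Borel sigma-algebra. *)
HB.instance Definition _ := @isMeasurable.Build default_measure_display
  'rV[R]_n (g_sigma_preimage rV_coord) rV_set0 rV_setC rV_bigcup.

Lemma measurable_rV_coord (i : 'I_n) : measurable_fun setT (rV_coord i).
Proof.
move=> _ Y mY; rewrite setTI; apply: sub_sigma_algebra => /=.
rewrite -bigcup_seq/=; exists i => /=; first by rewrite mem_index_enum.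
by exists Y => //; rewrite setTI.
Qed.

Lemma measurable_fun_rV d (T : measurableType d) (f : T -> 'rV[R]_n) :
  (forall i, measurable_fun setT (rV_coord i \o f)) -> measurable_fun setT f.
Proof.
move=> mf; have sub : g_sigma_preimage (fun i => rV_coord i \o f) `<=` measurable.
  apply: smallest_sub; first exact: sigma_algebra_measurable.
  rewrite -bigcup_seq/=; apply: bigcup_sub => i _ A [B mB <-].
  exact: mf.
move=> _ A mA; apply: sub; rewrite g_sigma_preimage_comp.
by exists A.
Qed.

End MeasurableRowVectors.

Section LebesgueMeasureRn.
Variable R : realType.

Definition rV_cons n (p : measurableTypeR R * 'rV[R]_n) : 'rV[R]_n.+1 :=
  \row_i oapp (p.2 ord0) p.1 (unlift ord0 i).

Definition rV_split n (x : 'rV[R]_n.+1) : measurableTypeR R * 'rV[R]_n :=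
  (x ord0 ord0, \row_j x ord0 (lift ord0 j)).

Lemma rV_consK n : cancel (@rV_cons n) (@rV_split n).
Proof.
move=> [a x]; rewrite /rV_split /rV_cons mxE unlift_none /=; congr pair.
by apply/rowP => j; rewrite !mxE liftK.
Qed.

Lemma measurable_rV_cons n : measurable_fun setT (@rV_cons n).
Proof.
apply: measurable_fun_rV => i.
case: (unliftP ord0 i) => [j|] ->.
  rewrite (_ : _ \o _ = @rV_coord R n j \o snd); last first.
    by apply/funext => p; rewrite /rV_coord /= mxE liftK.
  by apply: measurableT_comp => //; exact: measurable_rV_coord.
rewrite (_ : _ \o _ = fst) //.
by apply/funext => p; rewrite /rV_coord /= mxE unlift_none.
Qed.

Lemma measurable_rV_split n : measurable_fun setT (@rV_split n).
Proof.
apply/measurable_fun_pairP; split; first exact: (@measurable_rV_coord R n.+1).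
apply: measurable_fun_rV => j.
rewrite (_ : _ \o _ = @rV_coord R n.+1 (lift ord0 j)).
  exact: measurable_rV_coord.
by apply/funext => x; rewrite /rV_coord /= mxE.
Qed.

Section Step.
Variables (n : nat) (mu : {sigma_finite_measure set 'rV[R]_n -> \bar R}).

Definition lebesgue_rV_step : set 'rV[R]_n.+1 -> \bar R :=
  pushforward (lebesgue_measure \x mu)%E (@rV_cons n).

Let step0 : lebesgue_rV_step set0 = 0%E.
Proof. by rewrite /lebesgue_rV_step /pushforward preimage_set0 measure0. Qed.

Let step_ge0 A : (0 <= lebesgue_rV_step A)%E.
Proof. by rewrite /lebesgue_rV_step /pushforward; exact: measure_ge0. Qed.

Let step_sigma_additive : semi_sigma_additive lebesgue_rV_step.
Proof.
apply: (@measure_semi_sigma_additive _ _ _ (pushforward _ _)).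
exact: measurable_rV_cons.
Qed.

HB.instance Definition _ := isMeasure.Build _ _ _ lebesgue_rV_step
  step0 step_ge0 step_sigma_additive.

Let lebesgue_rV_step_sigma_finite : sigma_finite setT lebesgue_rV_step.
Proof.
have /sigma_finiteP[F [TF ndF Foo]] := sigma_finiteT (@lebesgue_measure R).
have /sigma_finiteP[G [TG ndG Goo]] := sigma_finiteT mu.
exists (fun k => @rV_split n @^-1` (F k `*` G k)).
  apply/esym/seteqP; split => // x _.
  have [i _ Fi] : (\bigcup_i F i) (rV_split x).1 by rewrite -TF.
  have [j _ Gj] : (\bigcup_i G i) (rV_split x).2 by rewrite -TG.
  exists (maxn i j) => //; split.
  - by move: (rV_split x).1 Fi; apply/subsetPset/ndF/leq_maxl.
  - by move: (rV_split x).2 Gj; apply/subsetPset/ndG/leq_maxr.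
move=> k; have [mF Fk] := Foo k; have [mG Gk] := Goo k; split.
  rewrite -[X in measurable X]setTI; apply: measurable_rV_split => //.
  exact: measurableX.
rewrite /lebesgue_rV_step /pushforward -comp_preimage.
rewrite (_ : _ \o _ = id); last exact/funext/rV_consK.
by rewrite preimage_id product_measure1E// lte_mul_pinfty// ge0_fin_numE.
Qed.

HB.instance Definition _ := @Measure_isSigmaFinite.Build _ _ _
  lebesgue_rV_step lebesgue_rV_step_sigma_finite.

End Step.

Fixpoint lebesgue_rV n : {sigma_finite_measure set 'rV[R]_n -> \bar R} :=
  match n with
  | 0 => dirac (0 : 'rV[R]_0)
  | n'.+1 => lebesgue_rV_step (lebesgue_rV n')
  end.

Lemma lebesgue_rV_box n (A : 'I_n -> set (measurableTypeR R)) :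
  (forall i, measurable (A i)) ->
  lebesgue_rV n [set x | forall i, A i (x ord0 i)] =
  (\prod_(i < n) lebesgue_measure (A i))%E.
Proof.
elim: n A => [|n IHn] A mA.
  rewrite big_ord0 /= diracE mem_set//=; by case.
rewrite big_ord_recl /= /lebesgue_rV_step /pushforward /=.
rewrite -IHn; last by move=> i; exact: mA.
have mB : measurable [set x : 'rV[R]_n | forall i, A (lift ord0 i) (x ord0 i)].
  rewrite (_ : mkset _ =
    \bigcap_(i in [set: 'I_n]) (@rV_coord R n i @^-1` A (lift ord0 i))).
    apply: fin_bigcap_measurable => // i _.
    by rewrite -[X in measurable X]setTI; apply: measurable_rV_coord.
  by apply/seteqP; split => x /= h i; [move=> _|]; apply: h.
rewrite -product_measure1E//; congr (_ _).
apply/seteqP; split => -[a x] /=.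
  move=> h; split; first by have := h ord0; rewrite mxE unlift_none.
  by move=> i; have := h (lift ord0 i); rewrite mxE liftK.
move=> [Aa Ax] i; rewrite mxE.
by case: (unliftP ord0 i) => [j|] ->; [exact: Ax|].
Qed.

End LebesgueMeasureRn.

Section Domain.
Variables (R : realType) (d : nat).
Local Notation V := 'rV[R]_d.
Local Notation mu := (lebesgue_rV R d).
Implicit Types (O : set V) (f g : V -> R) (G H : V -> V).

Definition domain O := [/\ open O, connected O & O !=set0].

Definition dot (x y : V) : R := \sum_i x ord0 i * y ord0 i.

(* The library's norm on row vectors is the sup norm. *)
Definition enorm (x : V) : R := Num.sqrt (dot x x).

Definition L2 O f :=
  measurable_fun O f /\ mu.-integrable O (fun x => (f x ^+ 2)%:E).

Definition ip O f g : R := \int[mu]_(x in O) (f x * g x).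

Definition ipv O G H : R := \int[mu]_(x in O) dot (G x) (H x).

Definition normv O G : R := Num.sqrt (ipv O G G).

Definition smooth (phi : V -> R) :=
  forall (vs : seq V) (x : V),
    differentiable (foldr (fun v (g : V -> R) => 'D_v g) phi vs) x.

Definition test_function O (phi : V -> R) :=
  smooth phi /\
  exists K, [/\ compact K, K `<=` O & forall x, ~ K x -> phi x = 0].

Definition weak_gradient O f G :=
  forall phi, test_function O phi -> forall i,
    \int[mu]_(x in O) (f x * 'D_(delta_mx ord0 i) phi x) =
    - \int[mu]_(x in O) (G x ord0 i * phi x).

(* A weak gradient is unique only up to null sets, so H^1(O) is represented
   by the graph of the weak gradient: pairs (f, G) of an L^2 function and a
   square-integrable representative of its weak gradient. [R^o] makes the
   pairs an [lmodType R], with componentwise operations. *)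
Definition H1pair : lmodType R := ((V -> R^o) * (V -> V))%type.

Definition grad (w : H1pair) : V -> V := w.2.

Definition H1 O : set H1pair :=
  [set w | [/\ L2 O w.1, forall i, L2 O (fun x => grad w x ord0 i)
              & weak_gradient O w.1 (grad w)]].

Definition conv_hull (a : seq V) : set V :=
  [set x | exists c : 'I_(size a) -> R,
     [/\ forall i, 0 <= c i, \sum_i c i = 1 & x = \sum_i c i *: a`_i]].

Definition diam (A : set V) : R :=
  sup [set r | exists x y, [/\ A x, A y & r = enorm (x - y)]].

(* A simplex is given by its d+1 vertices. *)
Definition nondegenerate (K : d.+1.-tuple V) :=
  row_free (\matrix_(i < d) (tnth K (lift ord0 i) - tnth K ord0)).

(* Conforming triangulation: two simplices meet in the face spanned by their
   common vertices, which is empty when there are none. *)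
Definition triangulation O (Th : seq (d.+1.-tuple V)) :=
  [/\ forall K, K \in Th -> nondegenerate K,
      closure O = [set x | exists2 K, K \in Th & conv_hull K x]
    & forall K L, K \in Th -> L \in Th ->
        conv_hull K `&` conv_hull L = conv_hull [seq a <- K | a \in tval L]].

Definition mesh_diameter (Th : seq (d.+1.-tuple V)) : R :=
  \big[Num.max/0]_(K <- Th) diam (conv_hull K).

Definition polynomial_le (s : nat) (p : V -> R) :=
  exists c : {ffun 'I_d -> 'I_s.+1} -> R, forall x,
    p x = \sum_(m : {ffun 'I_d -> 'I_s.+1} | (\sum_i m i <= s)%N)
            c m * \prod_i x ord0 i ^+ m i.

(* Conforming finite element spaces: linear subspaces of H^1(O), possibly with
   essential boundary conditions, of functions that are polynomials of total
   degree at most s on every closed simplex of a mesh; such functions are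
   automatically continuous on the closure of O. *)
Record fe_space O (s : nat) (h : R) (X : set H1pair) : Prop := FESpace {
  fe_H1 : X `<=` H1 O;
  fe_0 : X 0;
  fe_linear : forall (a : R) v w, X v -> X w -> X (a *: v + w);
  fe_poly : exists Th, [/\ triangulation O Th, mesh_diameter Th = h &
    forall v K, X v -> K \in Th ->
      exists2 p : V -> R, polynomial_le s p &
        forall x, conv_hull K x -> v.1 x = p x]
}.

End Domain.

Section DLN.
Variable R : realType.
Implicit Types (theta : R) (t : nat -> R).

Definition step t n : R := t n.+1 - t n.

Definition variability t n : R :=
  (step t n - step t n.-1) / (step t n + step t n.-1).

Definition alpha2 theta : R := (theta + 1) / 2.
Definition alpha1 theta : R := - theta.
Definition alpha0 theta : R := (theta - 1) / 2.

Definition avg_step theta t n : R :=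
  alpha2 theta * step t n - alpha0 theta * step t n.-1.

Definition beta2 theta (e : R) : R :=
  (1 + (1 - theta ^+ 2) / (1 + e * theta) ^+ 2
     + e ^+ 2 * (theta * (1 - theta ^+ 2) / (1 + e * theta) ^+ 2)
     + theta) / 4.
Definition beta1 theta (e : R) : R :=
  (1 - (1 - theta ^+ 2) / (1 + e * theta) ^+ 2) / 2.
Definition beta0 theta (e : R) : R :=
  (1 + (1 - theta ^+ 2) / (1 + e * theta) ^+ 2
     - e ^+ 2 * (theta * (1 - theta ^+ 2) / (1 + e * theta) ^+ 2)
     - theta) / 4.

Section Averages.
Variable W : lmodType R.
Implicit Type z : nat -> W.

Definition avg_theta theta z n : W :=
  ((1 + theta) / 2) *: z n + ((1 - theta) / 2) *: z n.-1.

Definition avg_alpha theta z n : W :=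
  alpha2 theta *: z n.+1 + alpha1 theta *: z n + alpha0 theta *: z n.-1.

Definition avg_beta theta t z n : W :=
  let e := variability t n in
  beta2 theta e *: z n.+1 + beta1 theta e *: z n + beta0 theta e *: z n.-1.

End Averages.

Definition F (x : R) : R := (x ^+ 2 - 1) ^+ 2 / 4.

Definition ftilde (a b : R) : R :=
  (a ^+ 3 + a ^+ 2 * b + a * b ^+ 2 + b ^+ 3 - 2 * (a + b)) / 4.

Definition model_energy d (O : set 'rV[R]_d) (eps theta : R)
    (u : nat -> H1pair R d) n : R :=
  eps ^+ 2 * ((1 + theta) / 4 * normv O (grad (u n)) ^+ 2
              + (1 - theta) / 4 * normv O (grad (u n.-1)) ^+ 2)
  + \int[lebesgue_rV R d]_(x in O) F ((avg_theta theta u n).1 x).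

End DLN.

(* Main.v *)
Require Import Defs.
From mathcomp Require Import all_boot all_order all_algebra.
From mathcomp Require Import all_classical all_reals all_analysis.
From mathcomp Require Import measurable_realfun zify ring lra.
Import Order.TTheory GRing.Theory Num.Theory.
Import numFieldNormedType.Exports.
Local Open Scope classical_set_scope.
Local Open Scope ring_scope.

(** Testing the scheme at step n with [avg_alpha theta u n], which lies in the
    finite element space because that space is linear, turns it into an energy
    balance with three terms.

    - The time-derivative term is the integral of a square divided by the
      average step, hence nonnegative.

    - In the diffusion term, the coefficients beta of the method are designed
      so that the product of the beta- and alpha-combinations of three numbers
      x, y, z is the increment of the quadratic form
      (1 + theta)/4 x^2 + (1 - theta)/4 y^2 plus a perfect square with a
      nonnegative coefficient: this is the G-stability of the method for every
      step ratio ([DLN_G_stability]). Applied to the components of the gradients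
      and integrated, it bounds the diffusion term from below by the increment
      of the gradient part of the model energy ([DLN_gradient_energy]).

    - In the nonlinear term, [ftilde] is the divided difference of F, and the
      test function is exactly the increment of the theta-averages
      ([avg_thetaB]), so the integrand telescopes to the increment of F along
      the theta-averages ([ftilde_chord]).

    The sum is zero, so the model energy cannot increase, whatever the
    steps.

    The remaining work is integrability, needed to split and compare the
    integrals. Products of gradient components are integrable because both
    factors are square integrable. Square integrability says nothing about
    the quartic potential; it is integrable because finite element functions
    are polynomials on finitely many simplices, hence bounded, on a domain that
    is bounded and therefore of finite measure ([F_fe_integrable]). *)

(** * Open sets and bounded sets in the product sigma-algebra *)

Lemma measurable_box {R : realType} {n : nat}
    (A : 'I_n -> set (measurableTypeR R)) :
  (forall i, measurable (A i)) ->
  measurable [set x : 'rV[R]_n | forall i, A i (x ord0 i)].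
Proof.
move=> mA.
rewrite (_ : mkset _ = \bigcap_(i in [set: 'I_n]) (@rV_coord R n i @^-1` A i)).
  apply: fin_bigcap_measurable => // i _.
  by rewrite -[X in measurable X]setTI; apply: measurable_rV_coord.
by apply/seteqP; split => x /= h i; [move=> _|]; apply: h.
Qed.

(** The measurable sets of row vectors are generated by the coordinates alone;
    an open set belongs to them because it is the union of the boxes with
    rational corners that it contains, and such boxes are countably many. *)
Lemma open_measurable_rV {R : realType} {n : nat} (O : set 'rV[R]_n) :
  open O -> measurable O.
Proof.
move=> oO.
pose B (ab : {ffun 'I_n -> rat} * {ffun 'I_n -> rat}) : set 'rV[R]_n :=
  [set x | forall i, x ord0 i \in `]ratr (ab.1 i), ratr (ab.2 i)[].
rewrite (_ : O = \bigcup_ab (if `[< B ab `<=` O >] then B ab else set0)).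
  apply: countable_bigcupT_measurable; first exact: countableP.
  move=> ab; case: asboolP => // _.
  exact: (measurable_box (fun i => [set` `]ratr (ab.1 i), ratr (ab.2 i)[])).
apply/seteqP; split=> [x Ox|x [ab _]]; last first.
  by case: asboolP => // sub; exact: sub.
have [e /= e0 xeO] : nbhs_ball x O by apply/nbhs_ballP; exact: open_nbhs_nbhs.
have [a ax] : exists a : {ffun 'I_n -> rat},
    forall i, ratr (a i) \in `]x ord0 i - e, x ord0 i[.
  have h i : exists q : rat, ratr q \in `]x ord0 i - e, x ord0 i[.
    by apply: rat_in_itvoo; lra.
  exists [ffun i => projT1 (cid (h i))] => i; rewrite ffunE.
  exact: projT2 (cid (h i)).
have [b bx] : exists b : {ffun 'I_n -> rat},
    forall i, ratr (b i) \in `]x ord0 i, x ord0 i + e[.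
  have h i : exists q : rat, ratr q \in `]x ord0 i, x ord0 i + e[.
    by apply: rat_in_itvoo; lra.
  exists [ffun i => projT1 (cid (h i))] => i; rewrite ffunE.
  exact: projT2 (cid (h i)).
(* A ball is a cube here, so the box between the corners a and b lies in it. *)
exists (a, b) => //; case: asboolP => [_ i|[]] /=.
  by have := ax i; have := bx i; rewrite !in_itv/=; lra.
move=> y By; apply: xeO; split=> // i j; rewrite ord1.
have := By j; have := ax j; have := bx j; rewrite !in_itv/= => h1 h2 h3.
by rewrite /ball/= ltr_norml; lra.
Qed.

Lemma lebesgue_rV_bounded {R : realType} {n : nat} (O : set 'rV[R]_n) (B : R) :
  measurable O -> (forall x, O x -> forall i, `|x ord0 i| <= B) ->
  (lebesgue_rV R n O < +oo)%E.
Proof.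
move=> mO OB; pose box : set 'rV[R]_n := [set x | forall i, x ord0 i \in `[- B, B]].
have mbox : measurable box by exact: (measurable_box (fun=> [set` `[- B, B]])).
apply: (@le_lt_trans _ _ (lebesgue_rV R n box)).
  apply: le_measure; rewrite ?inE// => x Ox i.
  by rewrite in_itv/= -ler_norml OB.
rewrite /box (lebesgue_rV_box (A := fun=> [set` `[- B, B]]))//.
rewrite ltey_eq prode_fin_num// => i _.
by rewrite lebesgue_measure_itv/=; case: ifP.
Qed.

(** * Boundedness of meshes and of finite element functions *)

Lemma uniform_bound_seq {R : realType} {T : eqType} (s : seq T)
    (P : T -> R -> Prop) :
  (forall K B B', B <= B' -> P K B -> P K B') ->
  (forall K, K \in s -> exists B, P K B) ->
  exists B, forall K, K \in s -> P K B.
Proof.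
move=> mono; elim: s => [|K s IH] ex; first by exists 0.
have [B1 h1] := ex K (mem_head _ _).
have [|B2 h2] := IH; first by move=> L Ls; apply: ex; rewrite in_cons Ls orbT.
exists (Num.max B1 B2) => L; rewrite in_cons => /predU1P[->|Ls].
  by apply: mono h1; rewrite le_max lexx.
by apply: mono (h2 _ Ls); rewrite le_max lexx orbT.
Qed.

Lemma conv_hull_bounded {R : realType} {d : nat} (a : seq 'rV[R]_d) :
  exists B, forall x, conv_hull a x -> forall j, `|x ord0 j| <= B.
Proof.
(* The coefficients lie in [0, 1], so each vertex contributes at most its size. *)
exists (\sum_(i < size a) \sum_j `|a`_i ord0 j|) => _ [c [c0 c1 ->]] j.
rewrite summxE; apply: le_trans (ler_norm_sum _ _ _) _.
apply: ler_sum => i _; rewrite mxE normrM ger0_norm//.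
rewrite (bigD1 j)//= -[leLHS]addr0 lerD ?sumr_ge0// ler_piMl//.
by rewrite -c1 (bigD1 i)//= lerDl sumr_ge0.
Qed.

Lemma polynomial_bounded {R : realType} {d s : nat} (p : 'rV[R]_d -> R) (B : R) :
  polynomial_le s p ->
  exists M, forall x : 'rV[R]_d, (forall j, `|x ord0 j| <= B) -> `|p x| <= M.
Proof.
move=> [c pE]; exists (\sum_(m : {ffun 'I_d -> 'I_s.+1} | (\sum_i m i <= s)%N)
  `|c m| * \prod_i B ^+ m i) => x xB.
rewrite pE; apply: le_trans (ler_norm_sum _ _ _) _.
apply: ler_sum => m _; rewrite normrM ler_wpM2l// normr_prod.
by apply: ler_prod => i _; rewrite normrX exprn_ge0//= lerXn2r// nnegrE//
  (le_trans _ (xB i)).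
Qed.

(** The finitely many simplices of the mesh are bounded and cover the closure
    of the domain; this gives the domain finite measure. *)
Lemma triangulated_bounded {R : realType} {d : nat} (O : set 'rV[R]_d)
    (Th : seq (d.+1.-tuple 'rV[R]_d)) :
  triangulation O Th ->
  exists B, forall x, O x -> forall j, `|x ord0 j| <= B.
Proof.
move=> [_ clO _].
have [|K _|B hB] := @uniform_bound_seq R _ Th
  (fun K B => forall x, conv_hull K x -> forall j, `|x ord0 j| <= B).
- by move=> K B B' BB' KB x Kx j; apply: le_trans (KB x Kx j) BB'.
- exact: conv_hull_bounded.
exists B => x /subset_closure; rewrite clO => -[K KTh Kx].
exact: hB Kx.
Qed.

(** On each of the finitely many simplices the function agrees with a
    polynomial, which is bounded on bounded sets. *)
Lemma fe_space_bounded {R : realType} {d s : nat} {O : set 'rV[R]_d} {h : R}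
    {X : set (H1pair R d)} (v : H1pair R d) :
  fe_space O s h X -> X v -> exists M, forall x, O x -> `|v.1 x| <= M.
Proof.
move=> feX Xv; have [Th [triTh _ polX]] := fe_poly feX.
have [|K KTh|M hM] := @uniform_bound_seq R _ Th
  (fun K M => forall x, conv_hull K x -> `|v.1 x| <= M).
- by move=> K B B' BB' KB x Kx; apply: le_trans (KB x Kx) BB'.
- have [p pp pv] := polX v K Xv KTh.
  have [B KB] := conv_hull_bounded (tval K).
  have [M pM] := polynomial_bounded p B pp.
  by exists M => x Kx; rewrite pv//; apply/pM/KB.
have [_ clO _] := triTh.
exists M => x /subset_closure; rewrite clO => -[K KTh Kx].
exact: hM Kx.
Qed.

(** * Integrability *)

(** The domination is |f g| <= f^2 + g^2. *)
Lemma L2_mul_integrable {R : realType} {d : nat} {O : set 'rV[R]_d} {f g} :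
  measurable O -> L2 O f -> L2 O g ->
  (lebesgue_rV R d).-integrable O (EFin \o (fun x => f x * g x)).
Proof.
move=> mO [mf f2] [mg g2].
apply: (le_integrable mO _ _ (integrableD mO f2 g2)).
  exact/measurable_EFinP/measurable_funM.
move=> x Ox /=; rewrite lee_fin.
rewrite ler_norml ger0_norm ?addr_ge0 ?sqr_ge0//; apply/andP; split.
  have := sqr_ge0 (f x + g x); have := sqr_ge0 (f x); have := sqr_ge0 (g x).
  by nra.
have := sqr_ge0 (f x - g x); have := sqr_ge0 (f x); have := sqr_ge0 (g x).
by nra.
Qed.

Lemma dot_integrable {R : realType} {d : nat} {O : set 'rV[R]_d}
    {G H : 'rV[R]_d -> 'rV[R]_d} :
  measurable O ->
  (forall i, L2 O (fun x => G x ord0 i)) ->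
  (forall i, L2 O (fun x => H x ord0 i)) ->
  (lebesgue_rV R d).-integrable O (EFin \o (fun x => dot (G x) (H x))).
Proof.
move=> mO LG LH.
rewrite (_ : _ \o _ = fun x => (\sum_i (G x ord0 i * H x ord0 i)%:E)%E).
  by apply: (integrable_sum mO) => i _; exact: L2_mul_integrable (LG i) (LH i).
by apply/funext => x /=; rewrite sumEFin.
Qed.

Lemma bounded_integrable {R : realType} {d : nat} {O : set 'rV[R]_d}
    {f : 'rV[R]_d -> R} (M : R) :
  measurable O -> (lebesgue_rV R d O < +oo)%E -> measurable_fun O f ->
  (forall x, O x -> `|f x| <= M) ->
  (lebesgue_rV R d).-integrable O (EFin \o f).
Proof.
move=> mO Ofin mf fM; apply: measurable_bounded_integrable => //.
exists M; split; first exact: num_real.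
by move=> B MB x Ox; exact: le_trans (fM x Ox) (ltW MB).
Qed.

(** * Algebra of the DLN coefficients *)

(** The gap between the two sides is
    theta (1 - theta^2) / (2 (1 + e theta)^2) times the square of
    y - (1 - e)/2 x - (1 + e)/2 z, which is the numerical dissipation of the
    method. *)
Lemma DLN_G_stability {R : realType} (theta e x y z : R) :
  0 <= theta <= 1 -> -1 < e < 1 ->
  (1 + theta) / 4 * (x ^+ 2 - y ^+ 2) + (1 - theta) / 4 * (y ^+ 2 - z ^+ 2) <=
  (beta2 theta e * x + beta1 theta e * y + beta0 theta e * z) *
  (alpha2 theta * x + alpha1 theta * y + alpha0 theta * z).
Proof.
move=> /andP[th0 th1] /andP[e1 e2].
have D0 : 0 < 1 + e * theta by nra.
rewrite -subr_ge0.
rewrite (_ : _ - _ = theta * (1 - theta ^+ 2) / (2 * (1 + e * theta) ^+ 2) *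
  (y - (1 - e) / 2 * x - (1 + e) / 2 * z) ^+ 2); last first.
  rewrite /beta2 /beta1 /beta0 /alpha2 /alpha1 /alpha0.
  by field; rewrite gt_eqF.
rewrite mulr_ge0 ?sqr_ge0// divr_ge0 ?mulr_ge0 ?sqr_ge0//; nra.
Qed.

Lemma ftilde_chord {R : realType} (a b : R) : ftilde a b * (a - b) = F a - F b.
Proof. by rewrite /ftilde /F; field. Qed.

(** This identity lets one test function serve two terms: it makes the
    time-derivative term a square and the nonlinear term an increment of F. *)
Lemma avg_thetaB {R : realType} {W : lmodType R} (theta : R) (z : nat -> W) n :
  avg_theta theta z n.+1 - avg_theta theta z n = avg_alpha theta z n.
Proof.
rewrite /avg_theta /avg_alpha /alpha2 /alpha1 /alpha0 /= opprD -!addrA.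
rewrite (addrC 1 theta); congr (_ + _); rewrite addrA -scalerBl.
rewrite -[- (_ *: z n.-1)]scaleNr.
by congr (_ *: _ + _ *: _); field.
Qed.

(** * The energy law *)

Lemma fe_space_comb3 {R : realType} {d s : nat} {O : set 'rV[R]_d} {h : R}
    {X : set (H1pair R d)} (a b c : R) (x y z : H1pair R d) :
  fe_space O s h X -> X x -> X y -> X z -> X (a *: x + b *: y + c *: z).
Proof.
move=> feX Xx Xy Xz; rewrite -addrA; apply: (fe_linear feX) => //.
apply: (fe_linear feX) => //.
by rewrite -[_ *: z]addr0; apply: (fe_linear feX) => //; exact: fe_0 feX.
Qed.

Lemma normv_sqr {R : realType} {d : nat} (O : set 'rV[R]_d) G :
  normv O G ^+ 2 = ipv O G G.
Proof.
rewrite sqr_sqrtr//; apply: Rintegral_ge0 => x _.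
by apply: sumr_ge0 => i _; rewrite -expr2 sqr_ge0.
Qed.

Lemma Rintegral_comb3 {R : realType} {d : nat} {O : set 'rV[R]_d}
    (a b c : R) (f g h : 'rV[R]_d -> R) :
  measurable O ->
  (lebesgue_rV R d).-integrable O (EFin \o f) ->
  (lebesgue_rV R d).-integrable O (EFin \o g) ->
  (lebesgue_rV R d).-integrable O (EFin \o h) ->
  (lebesgue_rV R d).-integrable O (EFin \o (fun x => a * f x + b * g x + c * h x)) /\
  \int[lebesgue_rV R d]_(x in O) (a * f x + b * g x + c * h x) =
  a * \int[lebesgue_rV R d]_(x in O) f x + b * \int[lebesgue_rV R d]_(x in O) g x
    + c * \int[lebesgue_rV R d]_(x in O) h x.
Proof.
move=> mO If Ig Ih.
have Iz k p : (lebesgue_rV R d).-integrable O (EFin \o p) ->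
    (lebesgue_rV R d).-integrable O (EFin \o (fun x => k * p x)).
  by move=> Ip; exact: (integrableZl mO k Ip).
have Ifg : (lebesgue_rV R d).-integrable O
    (EFin \o (fun x => a * f x + b * g x)).
  exact: (integrableD mO (Iz a f If) (Iz b g Ig)).
split; first exact: (integrableD mO Ifg (Iz c h Ih)).
by rewrite !RintegralD ?RintegralZl//; exact: Iz.
Qed.

(** [DLN_G_stability] summed over components and integrated. The combinations A
    and B are separate arguments, tied to X, Y, Z by pointwise equations, so that
    they may be the gradients of the averages of a sequence in H^1. *)
Lemma DLN_gradient_energy {R : realType} {d : nat} {O : set 'rV[R]_d}
    (theta e : R) (X Y Z B A : 'rV[R]_d -> 'rV[R]_d) :
  measurable O -> 0 <= theta <= 1 -> -1 < e < 1 ->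
  (forall i, L2 O (fun x => X x ord0 i)) ->
  (forall i, L2 O (fun x => Y x ord0 i)) ->
  (forall i, L2 O (fun x => Z x ord0 i)) ->
  (forall i, L2 O (fun x => B x ord0 i)) ->
  (forall i, L2 O (fun x => A x ord0 i)) ->
  (forall x, B x =
    beta2 theta e *: X x + beta1 theta e *: Y x + beta0 theta e *: Z x) ->
  (forall x, A x =
    alpha2 theta *: X x + alpha1 theta *: Y x + alpha0 theta *: Z x) ->
  (1 + theta) / 4 * normv O X ^+ 2 + (1 - theta) / 4 * normv O Y ^+ 2 <=
  (1 + theta) / 4 * normv O Y ^+ 2 + (1 - theta) / 4 * normv O Z ^+ 2
    + ipv O B A.
Proof.
move=> mO th he LX LY LZ LB LA BE AE.
pose q (G : 'rV[R]_d -> 'rV[R]_d) x := dot (G x) (G x).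
have [Iq Eq] := Rintegral_comb3 ((1 + theta) / 4)
  ((1 - theta) / 4 - (1 + theta) / 4) (- ((1 - theta) / 4)) (q X) (q Y) (q Z) mO
  (dot_integrable mO LX LX) (dot_integrable mO LY LY) (dot_integrable mO LZ LZ).
have le : \int[lebesgue_rV R d]_(x in O) ((1 + theta) / 4 * q X x +
    ((1 - theta) / 4 - (1 + theta) / 4) * q Y x + - ((1 - theta) / 4) * q Z x)
    <= ipv O B A.
  apply: (le_Rintegral mO Iq (dot_integrable mO LB LA)) => x _.
  rewrite /q /dot !mulr_sumr -!big_split/=; apply: ler_sum => i _.
  rewrite BE AE !mxE.
  by have := DLN_G_stability theta e (X x ord0 i) (Y x ord0 i) (Z x ord0 i)
    th he; lra.
rewrite !normv_sqr; move: le; rewrite Eq /ipv /q; lra.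
Qed.

(** Membership in L^2 does not control the fourth power in F; boundedness of
    finite element functions on a domain of finite measure does. *)
Lemma F_fe_integrable {R : realType} {d s : nat} {O : set 'rV[R]_d} {h : R}
    {X : set (H1pair R d)} (v : H1pair R d) :
  measurable O -> fe_space O s h X -> X v ->
  (lebesgue_rV R d).-integrable O (EFin \o (fun x => F (v.1 x))).
Proof.
move=> mO feX Xv.
have [Th [triTh _ _]] := fe_poly feX.
have [B OB] := triangulated_bounded O Th triTh.
have [M vM] := fe_space_bounded v feX Xv.
have [[mv _] _ _] := fe_H1 feX Xv.
apply: (bounded_integrable ((M ^+ 2 + 1) ^+ 2)) => //.
- exact: lebesgue_rV_bounded OB.
- rewrite /F; apply: measurable_funM => //; apply: measurable_funX.
  by apply: measurable_funB => //; apply: measurable_funX.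
move=> x /vM; rewrite ler_norml => /andP[M1 M2].
have v2 : 0 <= v.1 x ^+ 2 <= M ^+ 2 by rewrite sqr_ge0/=; nra.
rewrite /F ger0_norm ?divr_ge0 ?sqr_ge0//.
set w := v.1 x ^+ 2 in v2 *; set m := M ^+ 2 in v2 *.
by nra.
Qed.

(** This keeps the denominator 1 + e theta of the DLN coefficients positive. *)
Lemma variability_bound {R : realType} (t : nat -> R) n :
  0 < step t n -> 0 < step t n.-1 -> -1 < variability t n < 1.
Proof.
move=> k1 k0; have k : 0 < step t n + step t n.-1 by exact: addr_gt0.
by rewrite /variability ltr_pdivlMr// ltr_pdivrMr//; apply/andP; split; lra.
Qed.

Lemma energy_balance_decrease {R : realType} (eps m g p q a b : R) :
  0 <= m -> m + eps ^+ 2 * g + (p - q) = 0 -> a <= b + g ->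
  eps ^+ 2 * a + p <= eps ^+ 2 * b + q.
Proof.
by move=> m0 bal /(ler_wpM2l (sqr_ge0 eps)); rewrite mulrDr; lra.
Qed.

Theorem theorem3p1 (R : realType) (d : nat) (Omega : set 'rV[R]_d)
    (s : nat) (h : R) (Xh : set (H1pair R d))
    (theta eps T : R) (N : nat) (t : nat -> R) (u : nat -> H1pair R d) :
  (1 <= d <= 3)%N ->
  domain Omega ->
  0 < h ->
  fe_space Omega s h Xh ->
  0 <= theta <= 1 ->
  0 < eps ->
  t 0%N = 0 ->
  (forall n, (n < N)%N -> t n < t n.+1) ->
  t N = T ->
  (forall n, (n <= N)%N -> Xh (u n)) ->
  (forall n, (1 <= n <= N - 1)%N -> forall v, Xh v ->
    ip Omega ((avg_step theta t n)^-1 *: avg_alpha theta u n).1 v.1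
    + eps ^+ 2 * ipv Omega (grad (avg_beta theta t u n)) (grad v)
    + ip Omega (fun x => ftilde ((avg_theta theta u n.+1).1 x)
                                ((avg_theta theta u n).1 x)) v.1 = 0) ->
  forall n, (1 <= n <= N - 1)%N ->
    model_energy Omega eps theta u n.+1 <= model_energy Omega eps theta u n.
Proof.
move=> _ [oO _ _] _ feX th _ _ tinc _ Xu scheme n nN.
have mO := open_measurable_rV Omega oO.
have /andP[n0 nN1] := nN.
have Xm i : (i <= n.+1)%N -> Xh (u i) by move=> ?; apply: Xu; lia.
have Xz := Xm n.-1 ltac:(lia); have Xy := Xm n ltac:(lia).
have Xx := Xm n.+1 ltac:(lia).
have XA : Xh (avg_alpha theta u n).
  exact: (fe_space_comb3 _ _ _ _ _ _ feX Xx Xy Xz).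
have XB : Xh (avg_beta theta t u n).
  exact: (fe_space_comb3 _ _ _ _ _ _ feX Xx Xy Xz).
have k1 : 0 < step t n by rewrite subr_gt0; apply: tinc; lia.
have k0 : 0 < step t n.-1 by rewrite subr_gt0; apply: tinc; lia.
have L2grad v : Xh v -> forall i, L2 Omega (fun x => grad v x ord0 i).
  by move=> /(fe_H1 feX)[].
have balance := scheme n nN _ XA.
have mass : 0 <= ip Omega ((avg_step theta t n)^-1 *: avg_alpha theta u n).1
    (avg_alpha theta u n).1.
  apply: Rintegral_ge0 => x _.
  rewrite [X in X * _](_ : _ =
    (avg_step theta t n)^-1 * (avg_alpha theta u n).1 x)//.
  rewrite -mulrA mulr_ge0 -?expr2 ?sqr_ge0// invr_ge0 /avg_step /alpha2 /alpha0.
  by nra.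
have Xtheta j : (1 <= j <= n.+1)%N -> Xh (avg_theta theta u j).
  (* The average has two terms; a third one with coefficient 0 is added. *)
  move=> jn; rewrite -[avg_theta _ _ _]addr0 -(scale0r (u 0%N)).
  by apply: fe_space_comb3 feX _ _ _; apply: Xm; lia.
have IF j (jn : (1 <= j <= n.+1)%N) :=
  F_fe_integrable (avg_theta theta u j) mO feX (Xtheta j jn).
have potential : ip Omega (fun x => ftilde ((avg_theta theta u n.+1).1 x)
      ((avg_theta theta u n).1 x)) (avg_alpha theta u n).1 =
    \int[lebesgue_rV R d]_(x in Omega) F ((avg_theta theta u n.+1).1 x) -
    \int[lebesgue_rV R d]_(x in Omega) F ((avg_theta theta u n).1 x).
  rewrite -(RintegralB mO (IF n.+1 ltac:(lia)) (IF n ltac:(lia))).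
  by apply: eq_Rintegral => x _; rewrite -ftilde_chord -avg_thetaB.
have gradient := DLN_gradient_energy theta (variability t n) _ _ _
  (grad (avg_beta theta t u n)) (grad (avg_alpha theta u n)) mO th
  (variability_bound t n k1 k0) (L2grad _ Xx) (L2grad _ Xy) (L2grad _ Xz)
  (L2grad _ XB) (L2grad _ XA) (fun=> erefl) (fun=> erefl).
rewrite potential in balance.
exact: energy_balance_decrease mass balance gradient.
Qed.
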